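(* Let $C$ be a Reedy category and let $\Gamma$ be one of $\int N(C)$, $\int N^{-,+}(C)$, $\int N^{--,+}_+(C)$. Let $(\alpha,\theta)\colon([m],X)\to([n],Y)$ be a morphism in $\Gamma$. Consider the order-preserving map $\mathrm{pr}\colon\{(\beta,\varphi)\in\mathrm{Hom}_\Gamma(([m],X),([n],Y)):(\alpha,\theta)\le(\beta,\varphi)\}\to\{\beta\in\mathrm{Hom}_\Delta([m],[n]):\alpha\le\beta\}$, $(\beta,\varphi)\mapsto\beta$. Then the image of $\mathrm{pr}$ has a largest element $\alpha'$, and $\mathrm{pr}$ is an order isomorphism onto the interval $\{\beta\in\mathrm{Hom}_\Delta([m],[n]):\alpha\le\beta\le\alpha'\}$.
   Context: A Reedy category $(C,C_-,C_+)$: wide subcategories with unique factorization of every morphism as ($C_-$ then $C_+$), membership in $C_\pm$ decidable, and the relation ($x<'y$ iff non-identity $x\to y$ in $C_+$ or non-identity $y\to x$ in $C_-$) well-founded. $\Delta$: finite ordinals $[n]$ and order-preserving maps, hom-sets ordered pointwise. $\int N(C)$: objects $([n],X)$ with $X\colon[n]\to C$ a functor; morphisms $([m],X)\to([n],Y)$ are $(\alpha,\theta)$, $\alpha\colon[m]\to[n]$ in $\Delta$, $\theta\colon X\Rightarrow Y\circ\alpha$; composition $(\beta,\varphi)\circ(\alpha,\theta)=(\beta\alpha,(\varphi\alpha)\circ\theta)$. $\int N^{-,+}(C)$: subcategory of objects with $X$ sending all morphisms into $C_-$ and morphisms with all $\theta_i\in C_+$. $\int N^{--,+}_+(C)$: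 its subcategory of objects whose $X$ reflects identities and morphisms with $\alpha$ injective. Order on hom-sets: $(\alpha,\theta)\le(\alpha',\theta')$ iff $\alpha\le\alpha'$ pointwise and $\theta'_i=Y(\alpha(i)\le\alpha'(i))\circ\theta_i$ for all $i$. *)

(* Defs.v *)
(* [n] is represented by 'I_n.+1. *)
From mathcomp Require Import all_boot.
Set Implicit Arguments. Unset Strict Implicit. Unset Printing Implicit Defensive.

Record category := Category {
  Ob :> Type;
  Hom : Ob -> Ob -> Type;
  idm : forall a, Hom a a;
  comp : forall a b c, Hom b c -> Hom a b -> Hom a c;   (* comp g f = g o f *)
  comp_idl : forall a b (f : Hom a b), comp (idm b) f = f;
  comp_idr : forall a b (f : Hom a b), comp f (idm a) = f;
  comp_assoc : forall a b c d (f : Hom a b) (g : Hom b c) (h : Hom c d),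
      comp h (comp g f) = comp (comp h g) f }.
Arguments Hom {_}.
Arguments idm {_}.
Arguments comp {_ _ _ _}.

Definition is_identity (C : category) (a b : C) (f : Hom a b) : Prop :=
  exists e : a = b, match e in _ = b' return Hom a b' with erefl => idm a end = f.

Record reedy (C : category) := Reedy {
  minus : forall a b : C, Hom a b -> bool;   (* decidable membership in C_- *)
  plus  : forall a b : C, Hom a b -> bool;   (* decidable membership in C_+ *)
  minus_id : forall a : C, minus (idm a);
  plus_id : forall a : C, plus (idm a);
  minus_comp : forall (a b c : C) (f : Hom a b) (g : Hom b c),
      minus f -> minus g -> minus (comp g f);
  plus_comp : forall (a b c : C) (f : Hom a b) (g : Hom b c),
      plus f -> plus g -> plus (comp g f);
  fact_ex : forall (a b : C) (f : Hom a b),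
      exists c (g : Hom a c) (h : Hom c b), [/\ minus g, plus h & comp h g = f];
  fact_uniq : forall (a b : C) (f : Hom a b) (c c' : C)
      (g : Hom a c) (h : Hom c b) (g' : Hom a c') (h' : Hom c' b),
      minus g -> plus h -> comp h g = f ->
      minus g' -> plus h' -> comp h' g' = f ->
      existT (fun c => (Hom a c * Hom c b)%type) c (g, h) =
      existT (fun c => (Hom a c * Hom c b)%type) c' (g', h');
  reedy_wf : well_founded (fun x y : C =>
      (exists f : Hom x y, plus f /\ ~ is_identity f) \/
      (exists f : Hom y x, minus f /\ ~ is_identity f)) }.
Arguments minus {_} _ {_ _}.
Arguments plus {_} _ {_ _}.

(* ---------- Functors [n] -> C (objects of the nerve) ---------- *)
Record diagram (C : category) (n : nat) := Diagram {
  dob : 'I_n.+1 -> C;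
  dmor : forall i j : 'I_n.+1, (i <= j)%N -> Hom (dob i) (dob j);
  dmor_id : forall (i : 'I_n.+1) (h : (i <= i)%N), dmor h = idm (dob i);
  dmor_comp : forall (i j k : 'I_n.+1) (h1 : (i <= j)%N) (h2 : (j <= k)%N)
      (h3 : (i <= k)%N), dmor h3 = comp (dmor h2) (dmor h1) }.
Arguments dmor {_ _} _ {_ _}.

Definition monotone (m n : nat) (a : 'I_m.+1 -> 'I_n.+1) : Prop :=
  forall i j : 'I_m.+1, (i <= j)%N -> (a i <= a j)%N.

Definition leD (m n : nat) (a b : 'I_m.+1 -> 'I_n.+1) : Prop :=
  forall i, (a i <= b i)%N.

Inductive gamma := IntN | IntNmp | IntNmmp_p.
(* IntN = \int N(C), IntNmp = \int N^{-,+}(C), IntNmmp_p = \int N^{--,+}_+(C) *)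

Definition reflects_identities (C : category) n (X : diagram C n) : Prop :=
  forall (i j : 'I_n.+1) (h : (i <= j)%N), is_identity (dmor X h) -> i = j.

Definition gamma_ob (C : category) (R : reedy C) (G : gamma) n (X : diagram C n)
  : Prop :=
  match G with
  | IntN => True
  | IntNmp => forall (i j : 'I_n.+1) (h : (i <= j)%N), minus R (dmor X h)
  | IntNmmp_p => (forall (i j : 'I_n.+1) (h : (i <= j)%N), minus R (dmor X h))
                 /\ reflects_identities X
  end.

(* (a, th) is a morphism ([m],X) -> ([n],Y) of \int N(C) *)
Definition is_hom (C : category) m n (X : diagram C m) (Y : diagram C n)
  (a : 'I_m.+1 -> 'I_n.+1) (th : forall i, Hom (dob X i) (dob Y (a i))) : Prop :=
  monotone a /\
  forall (i j : 'I_m.+1) (h : (i <= j)%N) (h' : (a i <= a j)%N),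
    comp (dmor Y h') (th i) = comp (th j) (dmor X h).

Arguments is_hom {C m n} X Y a th.

Definition gamma_hom (C : category) (R : reedy C) (G : gamma) m n
  (X : diagram C m) (Y : diagram C n)
  (a : 'I_m.+1 -> 'I_n.+1) (th : forall i, Hom (dob X i) (dob Y (a i))) : Prop :=
  match G with
  | IntN => is_hom X Y a th
  | IntNmp => is_hom X Y a th /\ forall i, plus R (th i)
  | IntNmmp_p => [/\ is_hom X Y a th, forall i, plus R (th i) & injective a]
  end.

Arguments gamma_hom {C} R G {m n} X Y a th.

Definition le_hom (C : category) m n (X : diagram C m) (Y : diagram C n)
  (a : 'I_m.+1 -> 'I_n.+1) (th : forall i, Hom (dob X i) (dob Y (a i)))
  (b : 'I_m.+1 -> 'I_n.+1) (ph : forall i, Hom (dob X i) (dob Y (b i))) : Prop :=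
  leD a b /\ forall i (h : (a i <= b i)%N), ph i = comp (dmor Y h) (th i).

Arguments le_hom {C m n} X Y a th b ph.

Definition upper_hom (C : category) (R : reedy C) (G : gamma) m n
  (X : diagram C m) (Y : diagram C n)
  (a : 'I_m.+1 -> 'I_n.+1) (th : forall i, Hom (dob X i) (dob Y (a i)))
  (b : 'I_m.+1 -> 'I_n.+1) (ph : forall i, Hom (dob X i) (dob Y (b i))) : Prop :=
  gamma_hom R G X Y b ph /\ le_hom X Y a th b ph.
Arguments upper_hom {C} R G {m n} X Y a th b ph.

(* Main.v *)
(** Every morphism (b, ph) above (a, th) is forced to be ph_i = Y(a_i <= b_i) o th_i,
    so pr is injective and an order embedding, and its image consists of the monotone
    b >= a for which these composites lie in C_+ (for the last two choices of Gamma).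
    This image is closed under pointwise maximum and bounded, hence has a largest
    element a'.  It is also closed downwards in [a, a']: if g o f is in C_+ with g in
    C_-, then f is in C_+, because the C_- part of f must be an identity (unique
    factorization, and no C_- two-cycles by well-foundedness).  For the injectivity
    required in the last Gamma, a collision b_i = b_j with i < j would give a_j <= b_i,
    so a non-identity X(i <= j) in C_- would be followed by a map into C_+. *)

From Stdlib Require Import Classical FunctionalExtensionality.
From mathcomp Require Import all_boot zify.
Require Import Defs.
Set Implicit Arguments. Unset Strict Implicit. Unset Printing Implicit Defensive.

Lemma wf_asym (T : Type) (r : T -> T -> Prop) :
  well_founded r -> forall x y, r x y -> r y x -> False.
Proof.
move=> wf x; elim: (wf x) => {}x _ IH y rxy ryx.
exact: (IH y ryx x ryx rxy).
Qed.

Lemma ex_greatest_nat (P : nat -> Prop) k0 N :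
  P k0 -> (forall k, P k -> k <= N) -> exists2 k, P k & forall j, P j -> j <= k.
Proof.
move=> Pk0 bnd.
suff from_gap : forall d k, N - k < d -> P k -> exists2 k, P k & forall j, P j -> j <= k.
  exact: (from_gap _ k0 (ltnSn _) Pk0).
elim=> // d IH k gap Pk.
case: (classic (exists2 j, P j & k < j)) => [[j Pj kj]|no_more].
  by apply: (IH j) => //; have := bnd j Pj; lia.
exists k => // j Pj; rewrite leqNgt; apply/negP => kj.
by apply: no_more; exists j.
Qed.

Lemma ltn_sum (I : finType) (f g : I -> nat) i :
  (forall j, f j <= g j) -> f i < g i -> \sum_j f j < \sum_j g j.
Proof.
move=> fg fgi; rewrite (bigD1 i) //= [X in _ < X](bigD1 i) //= -addSn.
by apply: leq_add => //; apply: leq_sum.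
Qed.

Definition maxD m n (b c : 'I_m.+1 -> 'I_n.+1) : 'I_m.+1 -> 'I_n.+1 :=
  fun i => if (b i <= c i)%N then c i else b i.

Lemma leD_maxDl m n (b c : 'I_m.+1 -> 'I_n.+1) : leD b (maxD b c).
Proof. by move=> i; rewrite /maxD; case: ifP => // /idP. Qed.

Lemma monotone_maxD m n (b c : 'I_m.+1 -> 'I_n.+1) :
  monotone b -> monotone c -> monotone (maxD b c).
Proof.
move=> mb mc i j ij; rewrite /maxD; have := mb i j ij; have := mc i j ij.
by do 2 case: ifP => ?; lia.
Qed.

(* A greatest element is found by maximizing the sum of the values. *)
Lemma ex_greatest_maxD_closed m n (Q : ('I_m.+1 -> 'I_n.+1) -> Prop) b0 :
  Q b0 -> (forall b c, Q b -> Q c -> Q (maxD b c)) ->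
  exists2 g, Q g & forall b, Q b -> leD b g.
Proof.
move=> Qb0 Qmax.
pose S (b : 'I_m.+1 -> 'I_n.+1) := \sum_i (b i : nat).
have S_bound k : (exists2 b, Q b & S b = k) -> k <= \sum_(i < m.+1) n.
  by case=> b _ <-; apply: leq_sum => i _; exact: leq_ord.
have [_ [g Qg <-] Sg_max] := ex_greatest_nat (ex_intro2 _ _ b0 Qb0 erefl) S_bound.
exists g => // b Qb i; rewrite leqNgt; apply/negP => gb.
have := Sg_max _ (ex_intro2 _ _ _ (Qmax g b Qg Qb) erefl).
apply/negP; rewrite -ltnNge; apply: (ltn_sum (i := i)) => [j|]; first exact: leD_maxDl.
by rewrite /maxD (ltnW gb).
Qed.

Section ReedyFactorization.

Variables (C : category) (R : reedy C).

Lemma is_identity_existT (a c : C) (g : Hom a c) :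
  existT (fun c => Hom a c) c g = existT (fun c => Hom a c) a (idm a) -> is_identity g.
Proof.
move=> E.
suff K : forall s : {c : C & Hom a c},
    existT (fun c => Hom a c) a (idm a) = s -> is_identity (projT2 s).
  exact: (K _ (esym E)).
by move=> s E'; case: s / E'; exists erefl.
Qed.

(* Otherwise x and y would form a two-cycle of the well-founded Reedy relation. *)
Lemma minus_section_is_identity (a c e : C) (x : Hom a c) (y : Hom c e) :
  minus R x -> minus R y -> is_identity (comp y x) -> is_identity x.
Proof.
move=> mx my [E]; move: y my; case: e / E => y my /= yx_id.
case: (classic (is_identity x)) => // nx.
case: (classic (is_identity y)) => [[E y_id]|ny].
  move: x y mx my nx yx_id y_id; case: a / E => x y _ _ nx yx_id /= y_id.
  by case: nx; exists erefl; rewrite /= yx_id -y_id comp_idl.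
by case: (wf_asym (reedy_wf R) (x := a) (y := c)); right; [exists y | exists x].
Qed.

(* Both [(k x) o id] and [h o (g x)], with [k = h o g], factor [k x]. *)
Lemma minus_is_identity_of_plus_comp (a c b : C) (x : Hom a c) (k : Hom c b) :
  minus R x -> plus R (comp k x) -> is_identity x.
Proof.
move=> mx pkx.
have [e [g [h [mg ph kE]]]] := fact_ex R k.
have hgx : comp h (comp g x) = comp k x by rewrite comp_assoc kE.
have U := fact_uniq (minus_id R a) pkx (comp_idr _) (minus_comp mx mg) ph hgx.
have U1 := f_equal (fun s : {c : C & (Hom a c * Hom c b)%type} =>
   existT (fun c => Hom a c) (projT1 s) (projT2 s).1) U.
apply: (minus_section_is_identity mx mg); apply: is_identity_existT.
by rewrite /= in U1; rewrite -U1.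
Qed.

Lemma plus_of_minus_comp (a b d : C) (f : Hom a b) (g : Hom b d) :
  minus R g -> plus R (comp g f) -> plus R f.
Proof.
move=> mg pgf.
have [c [g' [h [mg' ph fE]]]] := fact_ex R f.
have [] : is_identity g'.
  by apply: (minus_is_identity_of_plus_comp (k := comp g h)) mg' _; rewrite -comp_assoc fE.
move=> E; move: g' h mg' ph fE; case: c / E => g' h _ ph fE /= g'E.
by rewrite -fE -g'E comp_idr.
Qed.

End ReedyFactorization.

Lemma dmor_irr (C : category) n (Y : diagram C n) (i j : 'I_n.+1) (h h' : (i <= j)%N) :
  dmor Y h = dmor Y h'.
Proof. by rewrite (bool_irrelevance h h'). Qed.

Lemma dmorC (C : category) n (Y : diagram C n) (i j k : 'I_n.+1)
  (h1 : (i <= j)%N) (h2 : (j <= k)%N) (h3 : (i <= k)%N) :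
  comp (dmor Y h2) (dmor Y h1) = dmor Y h3.
Proof. by rewrite (dmor_comp Y h1 h2 h3). Qed.

Section GammaAccessors.

Variables (C : category) (R : reedy C) (G : gamma) (m n : nat).
Variables (X : diagram C m) (Y : diagram C n).

Lemma gamma_hom_is_hom b (ph : forall i, Hom (dob X i) (dob Y (b i))) :
  gamma_hom R G X Y b ph -> is_hom X Y b ph.
Proof. by case: G => // [[]|[]]. Qed.

Lemma gamma_hom_plus b (ph : forall i, Hom (dob X i) (dob Y (b i))) :
  G <> IntN -> gamma_hom R G X Y b ph -> forall i, plus R (ph i).
Proof. by case: G => // _ []. Qed.

Lemma gamma_ob_minus : G <> IntN -> gamma_ob R G Y ->
  forall (i j : 'I_n.+1) (h : (i <= j)%N), minus R (dmor Y h).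
Proof. by case: G => //= _ []. Qed.

End GammaAccessors.

Section UpperSet.

Variables (C : category) (R : reedy C) (G : gamma) (m n : nat).
Variables (X : diagram C m) (Y : diagram C n).
Variables (a : 'I_m.+1 -> 'I_n.+1) (th : forall i, Hom (dob X i) (dob Y (a i))).

Definition lift_hom b (H : leD a b) : forall i, Hom (dob X i) (dob Y (b i)) :=
  fun i => comp (dmor Y (H i)) (th i).

(* The image of pr. *)
Definition liftable b : Prop :=
  [/\ monotone b, leD a b &
      G <> IntN -> forall i (h : (a i <= b i)%N), plus R (comp (dmor Y h) (th i))].

Lemma is_hom_lift b (H : leD a b) :
  is_hom X Y a th -> monotone b -> is_hom X Y b (lift_hom H).
Proof.
move=> [ma th_nat] mb; split=> // i j h h'.
have haj := ma i j h.
rewrite /lift_hom comp_assoc (dmorC Y (H i) h' (leq_trans (H i) h')).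
rewrite -comp_assoc -(th_nat i j h haj) comp_assoc.
by rewrite (dmorC Y haj (H j) (leq_trans (H i) h')).
Qed.

Lemma injective_of_plus_lift b :
  reflects_identities X -> (forall (i j : 'I_m.+1) (h : (i <= j)%N), minus R (dmor X h)) ->
  is_hom X Y a th -> leD a b ->
  (forall i (h : (a i <= b i)%N), plus R (comp (dmor Y h) (th i))) ->
  injective b.
Proof.
move=> reflX mX [ma th_nat] ab pb.
have lt_b_a : forall i j : 'I_m.+1, (i < j)%N -> (b i < a j)%N.
  move=> i j ij; rewrite ltnNge; apply/negP => aj_bi.
  have hij := ltnW ij; have aij := ma i j hij.
  have P := pb i (ab i).
  rewrite (dmor_irr Y (ab i) (leq_trans aij aj_bi)) in P.
  rewrite -(dmorC Y aij aj_bi (leq_trans aij aj_bi)) in P.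
  rewrite -comp_assoc (th_nat i j hij aij) comp_assoc in P.
  have := reflX _ _ hij (minus_is_identity_of_plus_comp (mX _ _ hij) P).
  by move=> E; rewrite E ltnn in ij.
move=> i j E; case: (ltngtP i j) => [ij|ji|/val_inj //].
  by have := leq_trans (lt_b_a _ _ ij) (ab j); rewrite E ltnn.
by have := leq_trans (lt_b_a _ _ ji) (ab i); rewrite E ltnn.
Qed.

Lemma liftable_upper b : gamma_ob R G X -> gamma_hom R G X Y a th ->
  liftable b -> exists ph, upper_hom R G X Y a th b ph.
Proof.
move=> hX hA [mb ab pb]; exists (lift_hom ab).
split; last by split=> // i h; rewrite (dmor_irr Y h (ab i)).
move: pb hX hA; case: G => /= pb hX hA.
- exact: is_hom_lift.
- by case: hA => hA _; split; [exact: is_hom_lift | move=> i; apply: pb].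
- case: hA => hA _ _; case: hX => mX reflX.
  split; [exact: is_hom_lift | by move=> i; apply: pb |].
  by apply: (injective_of_plus_lift reflX mX hA ab) => i h; apply: pb.
Qed.

Lemma upper_liftable b ph : upper_hom R G X Y a th b ph -> liftable b.
Proof.
case=> hb [ab phE]; split=> //; first exact: (gamma_hom_is_hom hb).1.
by move=> nG i h; rewrite -phE; exact: gamma_hom_plus nG hb i.
Qed.

Lemma liftable_refl : gamma_hom R G X Y a th -> liftable a.
Proof.
move=> hA; split=> //; first exact: (gamma_hom_is_hom hA).1.
by move=> nG i h; rewrite (dmor_id Y h) comp_idl; exact: gamma_hom_plus nG hA i.
Qed.

Lemma liftable_maxD b c : liftable b -> liftable c -> liftable (maxD b c).
Proof.
move=> [mb ab pb] [mc ac pc]; split; first exact: monotone_maxD.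
  by move=> i; apply: leq_trans (ab i) (leD_maxDl b c i).
by move=> nG i; rewrite /maxD; case: ifP => _ h; [apply: pc | apply: pb].
Qed.

Lemma liftable_down b b' : gamma_ob R G Y ->
  liftable b' -> monotone b -> leD a b -> leD b b' -> liftable b.
Proof.
move=> hY [_ _ pb'] mb ab bb'; split=> // nG i h.
have P := pb' nG i (leq_trans h (bb' i)).
rewrite -(dmorC Y h (bb' i) (leq_trans h (bb' i))) -comp_assoc in P.
exact: plus_of_minus_comp (gamma_ob_minus nG hY _) P.
Qed.

Lemma le_hom_unique b ph ph' :
  le_hom X Y a th b ph -> le_hom X Y a th b ph' -> ph = ph'.
Proof.
move=> [ab phE] [_ ph'E]; apply: functional_extensionality_dep => i.
by rewrite (phE i (ab i)) (ph'E i (ab i)).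
Qed.

Lemma le_hom_above b ph b' ph' :
  le_hom X Y a th b ph -> le_hom X Y a th b' ph' ->
  le_hom X Y b ph b' ph' <-> leD b b'.
Proof.
move=> [ab phE] [ab' ph'E]; split=> [[] //|bb'].
split=> // i h.
by rewrite (ph'E i (ab' i)) (phE i (ab i)) comp_assoc (dmorC Y (ab i) h (ab' i)).
Qed.

End UpperSet.

Theorem proposition4p4 (C : category) (R : reedy C) (G : gamma) (m n : nat)
  (X : diagram C m) (Y : diagram C n)
  (a : 'I_m.+1 -> 'I_n.+1) (th : forall i, Hom (dob X i) (dob Y (a i))) :
  gamma_ob R G X -> gamma_ob R G Y -> gamma_hom R G X Y a th ->
  exists a' : 'I_m.+1 -> 'I_n.+1,
    (* a' lies in the image of pr ... *)
    (exists ph' : forall i, Hom (dob X i) (dob Y (a' i)), upper_hom R G X Y a th a' ph') /\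
    (* ... and is its largest element *)
    (forall b ph, upper_hom R G X Y a th b ph -> leD b a') /\
    (* pr maps onto the interval {b : a <= b <= a'} of Hom_Delta([m],[n]) *)
    (forall b : 'I_m.+1 -> 'I_n.+1, monotone b -> leD a b -> leD b a' ->
       exists ph, upper_hom R G X Y a th b ph) /\
    (* pr is injective *)
    (forall b ph ph', upper_hom R G X Y a th b ph -> upper_hom R G X Y a th b ph' -> ph = ph') /\
    (* pr preserves and reflects the order *)
    (forall b ph b' ph', upper_hom R G X Y a th b ph -> upper_hom R G X Y a th b' ph' ->
       (le_hom X Y b ph b' ph' <-> leD b b')).
Proof.
move=> hX hY hA.
have [a' la' a'_max] :=
  ex_greatest_maxD_closed (liftable_refl hA) (@liftable_maxD _ R G _ _ X Y a th).
exists a'; split; first exact: liftable_upper.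
split; first by move=> b ph /upper_liftable; apply: a'_max.
split.
  by move=> b mb ab ba'; apply: liftable_upper => //; apply: (liftable_down hY la').
split; first by move=> b ph ph' [_ E] [_ E']; apply: le_hom_unique E E'.
by move=> b ph b' ph' [_ E] [_ E']; exact: le_hom_above E E'.
Qed.
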